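(* Let $f:\mathbb{N}^k\to\mathbb{C}$ with $f(\mathbf{1})\ne0$, and suppose there exist $C>0$ and $r_1,\ldots,r_k\in\mathbb{R}$ such that $|f(\mathbf{n})|\le C n_1^{r_1}\cdots n_k^{r_k}$ for all $\mathbf{n}\ne\mathbf{1}$. Let $\alpha_j>1+r_j$ $(j=1,\ldots,k)$ satisfy $\zeta(\alpha_1-r_1)\cdots\zeta(\alpha_k-r_k)\le 1+|f(\mathbf{1})|/C$. Then for all $\mathbf{n}\in\mathbb{N}^k$, $$|f^{-1}(\mathbf{n})|\le \frac{n_1^{\alpha_1}n_2^{\alpha_2}\cdots n_k^{\alpha_k}}{|f(\mathbf{1})|}.$$
   Context: $\mathbf{1}=(1,\ldots,1)$; $\zeta$ is the Riemann zeta function. The multiple Dirichlet product is $(f*g)(\mathbf{n})=\sum_{\mathbf{a}\cdot\mathbf{b}=\mathbf{n}} f(\mathbf{a})g(\mathbf{b})$ with $\mathbf{a}\cdot\mathbf{b}=(a_1b_1,\ldots,a_kb_k)$; its identity $I$ has $I(\mathbf{1})=1$, $I(\mathbf{n})=0$ otherwise; $f^{-1}$ is the function with $f*f^{-1}=I$. *)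

(* Defs.v *)
From mathcomp Require Import all_boot all_order all_algebra.
From mathcomp Require Import all_classical all_reals all_analysis.
From mathcomp Require Import complex.

Set Implicit Arguments.
Unset Strict Implicit.
Unset Printing Implicit Defensive.

Import Order.TTheory GRing.Theory Num.Theory.
Import numFieldNormedType.Exports.

Local Open Scope classical_set_scope.
Local Open Scope ring_scope.

(* The set N = {1, 2, ...} of positive integers. *)
Notation posnat := {n : nat | (0 < n)%N}.

Lemma muln_pos (a b : posnat) : (0 < val a * val b)%N.
Proof. by rewrite muln_gt0 (valP a) (valP b). Qed.

Definition pmul (a b : posnat) : posnat := Sub (val a * val b)%N (muln_pos a b).

Definition pone : posnat := Sub 1%N (ltn0Sn 0).

Notation pvec k := {ffun 'I_k -> posnat}.

Definition vone {k : nat} : pvec k := [ffun=> pone].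

Definition vmul {k : nat} (a b : pvec k) : pvec k := [ffun j => pmul (a j) (b j)].

Definition dirichlet_mul (K : fieldType) (k : nat) (f g : pvec k -> K) : pvec k -> K :=
  fun n => \sum_(ab \in [set ab : pvec k * pvec k | vmul ab.1 ab.2 = n])
             (f ab.1 * g ab.2).

Definition dirichlet_unit (K : fieldType) (k : nat) : pvec k -> K :=
  fun n => if n == vone then 1 else 0.

(* Meaningful only when f is invertible, e.g. when f vone != 0: see
   [dirichlet_mulV] and [dirichlet_inv_unique]. *)
Definition dirichlet_inv (K : fieldType) (k : nat) (f : pvec k -> K) : pvec k -> K :=
  xget (fun=> 0) [set g | dirichlet_mul f g = @dirichlet_unit K k].

(* [riemannR s] is n |-> (n + 1)^-s, indexed from 0.  The series converges for
   1 < s, the only case in which [zeta] is used. *)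
Definition zeta (R : realType) (s : R) : R := limn (series (riemannR s)).

(* The modulus on R[i] with values in R; the norm `|z| of the library lies
   in R[i]. *)
Notation cmod := ComplexField.Normc.normc.

Section Inverse.
Variables (K : fieldType) (k : nat).
Implicit Types (n a b : pvec k) (f g : pvec k -> K).

Definition factor_pairs n : set (pvec k * pvec k) := [set ab | vmul ab.1 ab.2 = n].
Definition weight n : nat := (\sum_j val (n j))%N.

Lemma vmul1 n : vmul vone n = n.
Proof. by apply/ffunP => j; apply/val_inj; rewrite !ffunE /= mul1n. Qed.

Lemma vmul_eqr a n : vmul a n = n -> a = vone.
Proof.
move=> e; apply/ffunP => j; apply/val_inj; rewrite ffunE /=.
move/ffunP/(_ j)/(congr1 val): e; rewrite ffunE /= => /eqP.
by rewrite -{2}(mul1n (val (n j))) eqn_pmul2r ?(valP (n j)) // => /eqP.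
Qed.

Lemma weight_ltn n a b : vmul a b = n -> a != vone -> (weight b < weight n)%N.
Proof.
move=> <- a1; have le j : (val (b j) <= val (vmul a b j))%N.
  by rewrite ffunE /= leq_pmull // (valP (a j)).
rewrite ltn_neqAle [X in _ && X]leq_sum // andbT; apply: contra a1 => /eqP e.
apply/eqP/(@vmul_eqr _ b)/ffunP => j; apply/val_inj/esym.
apply/eqP; rewrite eqn_leq le /= leqNgt; apply/negP => lt.
have : (weight b < weight (vmul a b))%N.
  rewrite /weight (bigD1 j) //= [leqRHS](bigD1 j) //= -addSn.
  by apply: leq_add => //; apply: leq_sum => i _; exact: le.
by rewrite e ltnn.
Qed.

Lemma finite_factor_pairs n : finite_set (factor_pairs n).
Proof.
pose N := (weight n).+1.
pose F (u : {ffun 'I_k -> 'I_N}) : pvec k := [ffun j => insubd pone (nat_of_ord (u j))].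
have fin : finite_set (range F) by exact/finite_image/finite_finset.
have inF (c : pvec k) : (forall j, val (c j) <= val (n j))%N -> range F c.
  move=> le; exists [ffun j => inord (val (c j))] => //.
  apply/ffunP => j; apply/val_inj; rewrite !ffunE.
  have -> : nat_of_ord (inord (val (c j)) : 'I_N) = val (c j).
    by apply: inordK; rewrite ltnS (leq_trans (le j)) // /weight (bigD1 j) //= leq_addr.
  by rewrite insubdK //; exact: (valP (c j)).
apply: sub_finite_set (finite_setX fin fin) => -[a b] /= abn.
split; apply: inF => j; rewrite -abn.
  by rewrite ffunE /= leq_pmulr // (valP (b j)).
by rewrite ffunE /= leq_pmull // (valP (a j)).
Qed.

Definition dtail f g n : K :=
  \sum_(ab \in factor_pairs n `\ (vone, n)) (f ab.1 * g ab.2).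

Lemma dirichlet_mulE f g n : dirichlet_mul f g n = f vone * g n + dtail f g n.
Proof.
rewrite /dirichlet_mul (@fsbigD1 _ _ _ _ (vone, n)) //=.
  exact: finite_factor_pairs.
exact: vmul1.
Qed.

Lemma eq_dtail f g h n : (forall m, (weight m < weight n)%N -> g m = h m) ->
  dtail f g n = dtail f h n.
Proof.
move=> e; apply: eq_fsbigr => -[a b] /set_mem/= [abn ne]; congr (_ * _).
apply: e; apply: (weight_ltn abn); apply/eqP => a1; apply: ne.
by move: abn a1; rewrite /factor_pairs /= => abn a1; move: abn; rewrite a1 vmul1 => ->.
Qed.

Lemma dirichlet_mul_inj f g h : f vone != 0 -> dirichlet_mul f g = dirichlet_mul f h -> g = h.
Proof.
move=> f1 e; apply/funext => n; have [w] := ubnP (weight n).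
elim: w n => // w IH n; rewrite ltnS => nw.
have := congr1 (@^~ n) e; rewrite /= !dirichlet_mulE (@eq_dtail f g h) => [|m mn].
  by move=> /addIr/(mulfI f1).
by apply: IH; exact: leq_trans nw.
Qed.

Definition dapprox f := fix G (m : nat) : pvec k -> K :=
  if m is m'.+1 then fun n => (dirichlet_unit K n - dtail f (G m') n) / f vone else fun=> 0.

Lemma dirichlet_inv_exists f : f vone != 0 -> exists g, dirichlet_mul f g = @dirichlet_unit K k.
Proof.
move=> f1; have st p q n : (weight n < p)%N -> (weight n < q)%N ->
    dapprox f p n = dapprox f q n.
  elim: p q n => // p IH [//|q] n /=; rewrite !ltnS => np nq.
  congr ((_ - _) / _); apply: eq_dtail => m mn.
  by apply: IH; [exact: leq_trans np | exact: leq_trans nq].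
exists (fun n => dapprox f (weight n).+1 n); apply/funext => n.
rewrite dirichlet_mulE (@eq_dtail f _ (dapprox f (weight n))) => [|m mn]; last first.
  exact: st.
by rewrite /= mulrC divfK // subrK.
Qed.

Lemma dirichlet_mulV f : f vone != 0 -> dirichlet_mul f (dirichlet_inv f) = @dirichlet_unit K k.
Proof.
move=> /dirichlet_inv_exists[g fg]; rewrite /dirichlet_inv.
exact: (@xgetI _ _ [set g | dirichlet_mul f g = @dirichlet_unit K k] g fg).
Qed.

Lemma dirichlet_inv_unique f g : f vone != 0 -> dirichlet_mul f g = @dirichlet_unit K k -> g = dirichlet_inv f.
Proof. by move=> f1 fg; apply: (dirichlet_mul_inj f1); rewrite fg dirichlet_mulV. Qed.

End Inverse.

(* Main.v *)
(* Write M = |f(1)|.  Isolating the factorization n = 1.n in (f * f^-1)(n) = 0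
   and inducting on n gives
     M |f^-1(n)| <= sum_{ab = n, a != 1} C a^r b^alpha / M
                  = (C / M) n^alpha sum_{a | n, a != 1} a^(r - alpha),
   and the last sum is at most prod_j zeta(alpha_j - r_j) - 1 <= M / C. *)
Require Import Defs.
From mathcomp Require Import all_boot all_order all_algebra.
From mathcomp Require Import all_classical all_reals all_analysis.
From mathcomp Require Import complex finmap ring.

Import Order.TTheory GRing.Theory Num.Theory.
Import numFieldNormedType.Exports.
Local Open Scope ring_scope.

Lemma riemannR0 (R : realType) (s : R) : riemannR s 0 = 1.
Proof. by rewrite /riemannR mulr1n powR1 invr1. Qed.

(* The terms (2m)^-s and (2m + 1)^-s are paired; when 1 < s, the ratio
   q = 2 / 2^s is < 1 and the partial sums are bounded by 1 / (1 - q). *)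
Lemma series_riemannR_double (R : realType) (s : R) (N : nat) : 0 <= s ->
  series (riemannR s) N.*2.+1 <= 1 + 2 / 2 `^ s * series (riemannR s) N.
Proof.
move=> s0; rewrite /series /=; elim: N => [|N IH].
  by rewrite big_nat1 big_geq // mulr0 addr0 riemannR0.
rewrite doubleS !(big_nat_recr N.*2.+2) // (big_nat_recr N.*2.+1) //= (big_nat_recr N) //=.
rewrite mulrDr addrA -addrA; apply: lerD => //.
have e : (N.*2.+2%:R : R) = 2 * N.+1%:R by rewrite -natrM mul2n doubleS.
have -> : 2 / 2 `^ s / N.+1%:R `^ s = (N.*2.+2%:R `^ s)^-1 *+ 2.
  by rewrite e powRM // -mulrA -invfM mulr_natl.
(* Each new pair is at most twice its larger term: (2N+2)^-s + (2N+3)^-s <= 2 (2N+2)^-s. *)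
rewrite mulr2n lerD2l lef_pV2 ?posrE ?powR_gt0 ?ltr0n //.
by apply: ge0_ler_powR; rewrite ?nnegrE ?ler0n // ler_nat.
Qed.

Lemma riemannR_ge0 (R : realType) (s : R) (i : nat) : 0 <= riemannR s i.
Proof. by rewrite invr_ge0 powR_ge0. Qed.

Lemma nondecreasing_series_riemannR (R : realType) (s : R) :
  nondecreasing_seq (series (riemannR s)).
Proof.
by move=> m n mn; apply: nondecreasing_series => // i _ _; exact: riemannR_ge0.
Qed.

Lemma is_cvg_series_riemannR (R : realType) (s : R) : 1 < s -> cvgn (series (riemannR s)).
Proof.
move=> s1; have s0 : 0 < s by exact: lt_trans s1.
have q1 : 2 / 2 `^ s < 1 :> R.
  (* Here q = 1 / 2^(s - 1), and the exponent s - 1 is positive. *)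
  rewrite -(mulr_powRB1 (ler0n _ 2) s0) invfM mulrA divff ?pnatr_eq0 // mul1r.
  have one : 1 `^ (s - 1) = 1 :> R by rewrite powR1.
  rewrite invf_lt1 ?powR_gt0 // -{1}one.
  by apply: gt0_ltr_powR; rewrite ?nnegrE ?subr_gt0 ?ltr1n ?ler0n.
apply: nondecreasing_is_cvgn; first exact: nondecreasing_series_riemannR.
exists (1 - 2 / 2 `^ s)^-1 => _ [N _ <-].
(* Monotonicity gives S_N <= S_(2N+1) <= 1 + q S_N, hence S_N (1 - q) <= 1. *)
rewrite -[X in _ <= X]mul1r ler_pdivlMr ?subr_gt0 // mulrBr mulr1 lerBlDr.
rewrite mulrC; apply: (le_trans _ (series_riemannR_double _ s N (ltW s0))).
by apply: nondecreasing_series_riemannR; rewrite -addnn leqW // leq_addr.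
Qed.

Lemma series_riemannR_le_zeta (R : realType) (s : R) (N : nat) : 1 < s ->
  \sum_(i < N) riemannR s i <= zeta s.
Proof.
move=> s1; rewrite -(big_mkord xpredT (riemannR s)).
apply: (@nondecreasing_cvgn_le _ (series (riemannR s))).
  exact: nondecreasing_series_riemannR.
exact: is_cvg_series_riemannR.
Qed.

(** By injectivity the left side is a subsum of the right one, and the omitted terms are
    nonnegative. *)
Lemma ler_sum_image (R : numDomainType) (S : eqType) (T : finType) (P : pred T)
    (r : seq S) (h : S -> T) (F : T -> R) :
  uniq r -> {in r &, injective h} -> {in r, forall x, P (h x)} -> (forall y, 0 <= F y) ->
  \sum_(x <- r) F (h x) <= \sum_(y | P y) F y.
Proof.
move=> ur hi hP F0; rewrite -(big_map h xpredT F) big_uniq ?map_inj_in_uniq //=.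
rewrite big_mkcond [leRHS]big_mkcond; apply: ler_sum => y _.
case: ifPn => [/mapP[x xr ->]|_]; first by rewrite hP.
by case: ifP.
Qed.

Lemma factor_le (k : nat) (n a b : pvec k) (j : 'I_k) :
  vmul a b = n -> (val (a j) <= weight n)%N.
Proof.
move=> <-; rewrite /weight (bigD1 j) //= ffunE /=.
by apply: leq_trans (leq_addr _ _); rewrite leq_pmulr // (valP (b j)).
Qed.

Lemma vmulI (k : nat) (a : pvec k) : injective (vmul a).
Proof.
move=> b c /ffunP e; apply/ffunP => j; apply/val_inj/eqP.
move: (e j); rewrite !ffunE => /(congr1 val)/eqP /=.
by rewrite eqn_pmul2l // (valP (a j)).
Qed.

(** A pair (a, b) with ab = n is determined by a, so the sum is part of a sum over a finite box of
    vectors. That sum factors into partial sums of zeta series; the vector 1, absent on the left,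
    accounts for the -1. *)
Lemma sum_factor_pairs_le_zeta (R : realType) (k : nat) (s : 'I_k -> R) (n : pvec k) :
  (forall j, 1 < s j) ->
  \sum_(ab \in (factor_pairs n `\ (vone, n))%classic)
     \prod_(j < k) riemannR (s j) (val (ab.1 j)).-1 <= \prod_(j < k) zeta (s j) - 1.
Proof.
move=> s1; pose N := weight n; set A := (_ `\ _)%classic.
have fA : finite_set A by exact/finite_setD/finite_factor_pairs.
(* The shift a_j - 1 matches the indexing of [riemannR] from 0. Entries of a are at most N, so
   [inord] never takes its default value on [A]. *)
pose h (ab : pvec k * pvec k) : {ffun 'I_k -> 'I_N.+1} :=
  [ffun j => inord (val (ab.1 j)).-1].
pose F (u : {ffun 'I_k -> 'I_N.+1}) := \prod_(j < k) riemannR (s j) (u j).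
pose u0 : {ffun 'I_k -> 'I_N.+1} := [ffun=> ord0].
have hE ab j : A ab -> h ab j = (val (ab.1 j)).-1 :> nat.
  case: ab => a b [abn _]; rewrite ffunE inordK // ltnS.
  by apply: leq_trans (leq_pred _) _; exact: factor_le abn.
have h_inj ab cd : A ab -> A cd -> h ab = h cd -> ab = cd.
  move=> Aab Acd e.
  have e1 : ab.1 = cd.1.
    apply/ffunP => j; apply/val_inj; move/ffunP/(_ j)/(congr1 val): e.
    rewrite /= !hE // => /(congr1 S).
    by rewrite !prednK //; [exact: (valP (cd.1 j)) | exact: (valP (ab.1 j))].
  case: ab cd Aab Acd e e1 => [a b] [c d] [abn _] [cdn _] _ /= ac.
  by move: abn; rewrite ac => /esym/(etrans cdn)/vmulI /= ->.
have -> : \sum_(ab \in A) \prod_(j < k) riemannR (s j) (val (ab.1 j)).-1 =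
          \sum_(ab \in A) F (h ab).
  by apply: eq_fsbigr => ab /set_mem Aab; apply: eq_bigr => j _; rewrite hE.
have Fu0 : F u0 = 1 by rewrite /F big1 // => j _; rewrite ffunE riemannR0.
apply: (@le_trans _ _ (\sum_(u | u != u0) F u)).
  rewrite fsbig_finite //=; apply: ler_sum_image.
  - exact: fset_uniq.
  - by move=> ab cd; rewrite !in_fset_set // => /set_mem ? /set_mem ?; exact: h_inj.
  (* The zero vector is not attained: it would force a = 1, hence the excluded pair (1, n). *)
  - move=> ab; rewrite in_fset_set // => /set_mem Aab; apply/eqP => e.
    case: (Aab) => abn; apply => /=.
    have a1 : ab.1 = vone.
      apply/ffunP => j; apply/val_inj; move/ffunP/(_ j)/(congr1 val): e.
      rewrite /= hE // !ffunE /= => /(congr1 S); rewrite prednK //; exact: (valP (ab.1 j)).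
    by move: abn; rewrite /factor_pairs /= a1 vmul1 -a1 => <-; case: (ab).
  - by move=> u; apply: prodr_ge0 => j _; exact: riemannR_ge0.
have -> : \sum_(u | u != u0) F u = \sum_u F u - 1.
  by rewrite [X in _ = X - _](bigD1 u0) //= Fu0 [1 + _]addrC addrK.
rewrite lerD2r /F.
(* Distributivity turns the sum over the box into a product of partial sums. *)
rewrite -(bigA_distr_bigA (fun j (i : 'I_N.+1) => riemannR (s j) i)).
apply: ler_prod => j _; rewrite series_riemannR_le_zeta // andbT.
by apply: sumr_ge0 => i _; exact: riemannR_ge0.
Qed.

Lemma cmod_ge0 (R : rcfType) (z : R[i]) : 0 <= cmod z.
Proof. by rewrite -lecR; exact: (normr_ge0 z). Qed.

(** Embedded in R[i], [cmod] is the library norm, whose triangle inequality transfers to R. *)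
Lemma cmod_sum (R : rcfType) (I : Type) (r : seq I) (F : I -> R[i]) :
  cmod (\sum_(i <- r) F i) <= \sum_(i <- r) cmod (F i).
Proof.
rewrite -lecR rmorph_sum /=; exact: (@ler_norm_sum _ R[i]).
Qed.

Theorem theorem3p4 (R : realType) (k : nat) (f : pvec k -> R[i])
    (C : R) (r alpha : 'I_k -> R)
    (f1_neq0 : f vone != 0) (C_gt0 : 0 < C)
    (f_bound : forall n : pvec k, n != vone ->
       cmod (f n) <= C * \prod_(j < k) (val (n j))%:R `^ r j)
    (alpha_gt : forall j : 'I_k, 1 + r j < alpha j)
    (zeta_le : \prod_(j < k) zeta (alpha j - r j) <= 1 + cmod (f vone) / C) :
  forall n : pvec k,
    cmod (dirichlet_inv f n) <=
      (\prod_(j < k) (val (n j))%:R `^ alpha j) / cmod (f vone).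
Proof.
pose M : R := cmod (f vone).
have M_gt0 : 0 < M.
  rewrite lt_neqAle cmod_ge0 andbT eq_sym; apply: contra f1_neq0 => /eqP.
  by move/ComplexField.Normc.eq0_normc => ->.
pose P (al : 'I_k -> R) (n : pvec k) := \prod_(j < k) (val (n j))%:R `^ al j.
have P_ge0 al n : 0 <= P al n by apply: prodr_ge0 => j _; exact: powR_ge0.
(* Strong induction on the weight: if ab = n and a is not 1, then b has smaller weight than n. *)
move=> n; rewrite -/M -/(P alpha n); have [w] := ubnP (weight n).
elim: w n => // w IH n; rewrite ltnS => nw.
have := congr1 (@^~ n) (dirichlet_mulV f1_neq0).
rewrite dirichlet_mulE /dirichlet_unit => /(canRL (addrK _)) eq_fg.
rewrite ler_pdivlMr // mulrC -ComplexField.Normc.normcM eq_fg.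
have [->|n1] := eqVneq n vone.
  (* For n = 1 the tail is empty, since ab = 1 forces a = b = 1; the claim reduces to 1 <= 1. *)
  rewrite /dtail fsbig1 => [|[a b] [/= ab ne]]; last first.
    have b1 : b = vone.
      apply/ffunP => j; apply/val_inj; move/ffunP/(_ j)/(congr1 val)/eqP: ab.
      by rewrite !ffunE /= muln_eq1 => /andP[_ /eqP].
    by case: ne; move: ab; rewrite b1 => /vmul_eqr /= ->.
  rewrite subr0 ComplexField.Normc.normc1 /P big1 // => j _.
  by rewrite ffunE powR1.
rewrite sub0r normcN /dtail.
set A := (_ `\ _)%classic.
have fA : finite_set A by exact/finite_setD/finite_factor_pairs.
rewrite fsbig_finite //=; apply: le_trans (cmod_sum _ _ _ _) _.
pose s j := alpha j - r j.
have s1 j : 1 < s j by rewrite ltrBrDr.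
apply: (@le_trans _ _ (\sum_(ab <- fset_set A)
  C / M * P alpha n * \prod_(j < k) riemannR (s j) (val (ab.1 j)).-1)).
  rewrite big_seq [leRHS]big_seq; apply: ler_sum => -[a b] /=.
  rewrite in_fset_set // => /set_mem[/= abn ne].
  have a1 : a != vone.
    by apply/eqP => a1; apply: ne; rewrite -abn /= a1 vmul1.
  rewrite ComplexField.Normc.normcM.
  have -> : C / M * P alpha n * \prod_(j < k) riemannR (s j) (val (a j)).-1 =
            (C * P r a) * (P alpha b / M).
    (* Since n = ab, this is n^alpha a^(r - alpha) = a^r b^alpha, checked coordinatewise. *)
    have e : P alpha n * \prod_(j < k) riemannR (s j) (val (a j)).-1 = P r a * P alpha b.
      rewrite -abn /P -!big_split /=; apply: eq_bigr => j _ /=.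
      have a_gt0 := valP (a j); rewrite ffunE /riemannR /= prednK // natrM powRM //.
      rewrite -{1}(subrKC (r j) (alpha j)) powRD; last first.
        by rewrite pnatr_eq0 -lt0n a_gt0 implybT.
      rewrite mulrAC -!mulrA; congr (_ * _).
      by rewrite mulrA divff ?mul1r // gt_eqF // powR_gt0 // ltr0n.
    by rewrite -(mulrA (C / M)) e; ring.
  (* The growth hypothesis bounds f(a), the induction hypothesis f^-1(b). *)
  apply: ler_pM; rewrite ?cmod_ge0 ?f_bound //.
  by apply: IH; apply: leq_trans nw; exact: (weight_ltn abn).
rewrite -mulr_sumr -(fsbig_finite _ _ fA).
(* The hypothesis on the zeta product bounds the divisor sum by M / C, which cancels the factor C /
   M. *)
apply: (@le_trans _ _ (C / M * P alpha n * (M / C))).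
  apply: ler_wpM2l; first by rewrite !mulr_ge0 ?invr_ge0 // ltW.
  apply: le_trans (sum_factor_pairs_le_zeta _ _ _ _ s1) _.
  by rewrite lerBlDl.
by rewrite mulrAC -invf_div mulVf ?mul1r // mulf_neq0 ?invr_eq0 ?gt_eqF.
Qed.
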